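(* Let $|q|<1$. Then $$\left[\frac{d^2}{dz^2}(zq;q)_\infty(z^{-1}q;q)_\infty(z^2q;q^2)_\infty(z^{-2}q;q^2)_\infty\right]_{z=1}=-2(q;q)_\infty^2(q;q^2)_\infty^2\left\{3\sum_{n=1}^\infty\frac{nq^n}{1-q^n}+2\sum_{n=1}^\infty\frac{(2n-1)q^{2n-1}}{1-q^{2n-1}}\right\}.$$
   Context: For complex $A$ and a base $Q$ with $|Q|<1$: $(A;Q)_\infty=\prod_{j=1}^{\infty}(1-AQ^{j-1})$. *)

(* Defs.v *)
From mathcomp Require Import all_boot all_order all_algebra.
From mathcomp Require Import all_classical all_reals all_analysis.
From mathcomp Require Import complex.

Set Implicit Arguments.
Unset Strict Implicit.
Unset Printing Implicit Defensive.

Import Order.TTheory GRing.Theory Num.Theory.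
Import numFieldNormedType.Exports.

Local Open Scope classical_set_scope.
Local Open Scope ring_scope.

(* The complex numbers R[i], bundled as a numFieldType: the topology and
   the normed structure of a numeric field over itself are only inferred when
   the carrier is the sort of such a structure, not for the bare type R[i]. *)
Definition CC (R : realType) : numFieldType := R[i].

(* (A; Q)_oo; the partial products converge if |Q| < 1. *)
Definition qpoch (R : realType) (A Q : CC R) : CC R :=
  \big[*%R/1]_(1 <= j <oo) (1 - A * Q ^+ (j - 1)).

(* Main.v *)
(* Put u(z) = z + 1/z - 2, which vanishes to second order at z = 1.  Since
   (1 - z x) (1 - x / z) = (1 - x)^2 (1 - u(z) x / (1 - x)^2), the function to be
   differentiated is F(z) = F(1) P(u(z)) Q(u(z^2)), where P and Q are infinite
   products of linear factors 1 - y_j u.  The partial products satisfy a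
   second-order Taylor bound with a constant independent of the number of
   factors; it survives the limit, so P and Q are differentiable near 0 and
   their derivatives are continuous at 0, with P'(0) = - sum_j y_j.  As F'(z) is
   (z - 1) times a function continuous at 1, F''(1) = F(1) (2 P'(0) + 8 Q'(0)).
   Finally sum_j a p^j / (1 - a p^j)^2 = sum_m m a^m / (1 - p^m), by truncating
   the double series sum m a^m p^(j m) to a square, and splitting by parity gives
   2 sum n q^n / (1 - q^(2n)) =
     sum n q^n / (1 - q^n) + sum_(n odd) n q^n / (1 - q^n). *)
Require Import Defs.
From mathcomp Require Import all_boot all_order all_algebra.
From mathcomp Require Import all_classical all_reals all_analysis.
From mathcomp Require Import complex ring lra.

Set Implicit Arguments.
Unset Strict Implicit.
Unset Printing Implicit Defensive.

Import Order.TTheory GRing.Theory Num.Theory.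
Import numFieldNormedType.Exports.
Local Open Scope classical_set_scope.
Local Open Scope ring_scope.

(* The modulus as an element of R rather than of R[i], so that estimates take
   place in a totally ordered field. *)
Definition cmod (R : realType) (x : CC R) : R := complex.Re (`|x| : R[i]).

(** * Real-valued modulus and convergence in the complex numbers *)

Section Modulus.
Variable R : realType.
Implicit Types x y : CC R.

Lemma cmodE x : ((cmod x)%:C)%C = `|x|.
Proof. by apply/RRe_real/normr_real. Qed.

Lemma cmod_ge0 x : 0 <= cmod x.
Proof. by rewrite -ler0c cmodE normr_ge0. Qed.

Lemma cmodM x y : cmod (x * y) = cmod x * cmod y.
Proof. by apply: complexI; rewrite rmorphM /= !cmodE normrM. Qed.

Lemma cmodD x y : cmod (x + y) <= cmod x + cmod y.
Proof. by rewrite -lecR rmorphD /= !cmodE ler_normD. Qed.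

Lemma cmodN x : cmod (- x) = cmod x.
Proof. by apply: complexI; rewrite !cmodE normrN. Qed.

Lemma cmod0 : cmod (0 : CC R) = 0.
Proof. by apply: complexI; rewrite !cmodE normr0. Qed.

Lemma cmod1 : cmod (1 : CC R) = 1.
Proof. by apply: complexI; rewrite !cmodE normr1. Qed.

Lemma cmodX x n : cmod (x ^+ n) = cmod x ^+ n.
Proof. by elim: n => [|n IH]; rewrite ?expr0 ?cmod1// !exprS cmodM IH. Qed.

Lemma cmodV x : cmod x^-1 = (cmod x)^-1.
Proof. by apply: complexI; rewrite fmorphV /= !cmodE normfV. Qed.

Lemma cmod_nat n : cmod (n%:R : CC R) = n%:R.
Proof. by apply: complexI; rewrite cmodE normr_nat rmorph_nat. Qed.

Lemma cmod_eq0 x : (cmod x == 0) = (x == 0).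
Proof.
rewrite -[RHS]normr_eq0 -cmodE; apply/eqP/eqP => [->//|H].
exact: (@complexI _ _ 0).
Qed.

Lemma cmodB_ge x y : cmod x - cmod y <= cmod (x - y).
Proof. by have := cmodD (x - y) y; rewrite subrK; lra. Qed.

Lemma cmod_sum (I : Type) (s : seq I) (P : pred I) (f : I -> CC R) :
  cmod (\sum_(i <- s | P i) f i) <= \sum_(i <- s | P i) cmod (f i).
Proof.
elim/big_ind2: _ => [|a b c d ab cd|//]; first by rewrite cmod0.
by apply: (le_trans (cmodD _ _)); apply: lerD.
Qed.

Lemma cmod_lt x (e : R) : (`|x| < (e%:C)%C :> CC R) = (cmod x < e).
Proof. by rewrite -ltcR cmodE. Qed.

Lemma normr_cmod x : `|0 - cmod x| = cmod x.
Proof. by rewrite sub0r normrN ger0_norm ?cmod_ge0. Qed.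

Lemma cvg_cmodP (T : Type) (F : set_system T) {FF : Filter F}
    (f : T -> CC R) (l : CC R) :
  f @ F --> l <-> (fun t => cmod (f t - l)) @ F --> (0 : R).
Proof.
split=> H.
- apply/cvgrPdist_lt => e e0.
  have e0' : (0 : CC R) < (e%:C)%C by rewrite -[0]/((0%:C)%C : R[i]) ltcR.
  have /cvgrPdist_lt/(_ _ e0') := H.
  by apply: filterS => t; rewrite normr_cmod -cmod_lt distrC.
- apply/cvgrPdist_lt => e e0.
  (* In [R[i]] a positive element is necessarily real, so a tolerance [e] there is the image of its
     real part. *)
  have er : (e : R[i]) = (((complex.Re (e : R[i]))%:C)%C : R[i]).
    by rewrite RRe_real// ger0_real// ltW.
  have e0' : 0 < complex.Re (e : R[i]) by rewrite -ltcR -er.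
  have /cvgrPdist_lt/(_ _ e0') := H.
  by apply: filterS => t; rewrite normr_cmod -cmod_lt -er distrC.
Qed.

Lemma cvg_cmod (T : Type) (F : set_system T) {FF : Filter F}
    (f : T -> CC R) (l : CC R) :
  f @ F --> l -> (fun t => cmod (f t)) @ F --> cmod l.
Proof.
move=> /cvg_cmodP H; apply/cvgrPdist_lt => e e0.
have /cvgrPdist_lt/(_ _ e0) := H.
apply: filterS => t; rewrite normr_cmod.
apply: le_lt_trans; rewrite ler_norml.
have := cmodB_ge l (f t); have := cmodB_ge (f t) l.
by rewrite -(cmodN (l - f t)) opprB; lra.
Qed.

Lemma cvg_cmod_le (T : Type) (F : set_system T) {FF : Filter F}
    (f : T -> CC R) (l : CC R) (b : T -> R) :
  (\forall t \near F, cmod (f t - l) <= b t) -> b @ F --> 0 -> f @ F --> l.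
Proof.
move=> fb b0; apply/cvg_cmodP.
apply: (squeeze_cvgr _ (cvg_cst 0) b0).
by apply: filterS fb => t ->; rewrite cmod_ge0.
Qed.

Lemma cmod_lim_le (u : (CC R)^nat) (l : CC R) (b : R) :
  u @ \oo --> l -> (forall n, cmod (u n) <= b) -> cmod l <= b.
Proof.
move=> /cvg_cmod ul ub.
by apply: (ler_cvg_to ul (cvg_cst b)); apply: nearW.
Qed.

Lemma cmodE_normc x : cmod x = Normc.normc (x : R[i]).
Proof. by []. Qed.

Lemma Re_le_cmod (x : R[i]) : `|complex.Re x| <= cmod (x : CC R).
Proof.
rewrite cmodE_normc; case: x => a b /=.
by rewrite -sqrtr_sqr ler_wsqrtr// lerDl sqr_ge0.
Qed.

Lemma Im_le_cmod (x : R[i]) : `|complex.Im x| <= cmod (x : CC R).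
Proof.
rewrite cmodE_normc; case: x => a b /=.
by rewrite -sqrtr_sqr ler_wsqrtr// lerDr sqr_ge0.
Qed.

Lemma cmod_le_ReIm (x : R[i]) :
  cmod (x : CC R) <= `|complex.Re x| + `|complex.Im x|.
Proof.
rewrite cmodE_normc; case: x => a b /=.
rewrite -[leRHS]ger0_norm ?addr_ge0// -sqrtr_sqr ler_wsqrtr//.
rewrite sqrrD !real_normK ?num_real// lerD2r lerDl.
by rewrite mulrn_wge0// mulr_ge0.
Qed.

(** The increments form an absolutely convergent series, and telescoping recovers [u] up to the
    constant [u 0]. *)
Lemma cvg_real_dominated (u a : R^nat) :
  (forall n, `|u n.+1 - u n| <= a n) -> cvgn (series a) -> cvgn u.
Proof.
move=> ua ca.
have : cvgn (series (telescope u)).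
  apply: normed_cvg; apply: (@series_le_cvg _ _ a) => //.
  - by move=> n /=; apply: normr_ge0.
  - by move=> n; apply: le_trans (normr_ge0 _) (ua n).
rewrite telescopeK => cu.
have -> : u = (fun n => u n - u 0%N) \+ cst (u 0%N).
  by apply/funext => n /=; rewrite subrK.
by apply: is_cvgD => //; apply: is_cvg_cst.
Qed.

(** Real and imaginary parts have increments no larger than those of [u], so the real criterion
    applies to each; the two limits are then reassembled. *)
Lemma cvg_dominated (u : (CC R)^nat) (a : R^nat) :
  (forall n, cmod (u n.+1 - u n) <= a n) -> cvgn (series a) -> cvgn u.
Proof.
move=> ua ca.
pose re n := complex.Re (u n : R[i]); pose im n := complex.Im (u n : R[i]).
have cre : cvgn re.
  apply: cvg_real_dominated ca => n; apply: le_trans (ua n).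
  by apply: le_trans (Re_le_cmod _); rewrite raddfB.
have cim : cvgn im.
  apply: cvg_real_dominated ca => n; apply: le_trans (ua n).
  by apply: le_trans (Im_le_cmod _); rewrite raddfB.
apply/cvg_ex; exists ((limn re +i* limn im)%C : CC R).
apply: (@cvg_cmod_le _ _ _ _ _
  (fun n => `|re n - limn re| + `|im n - limn im|)).
- apply: nearW => n.
  by apply: le_trans (cmod_le_ReIm _) _; rewrite !raddfB.
- rewrite -[0 : R]addr0; apply: cvgD.
  + rewrite -(normr0 R) -(subrr (limn re)).
    by apply: cvg_norm; apply: cvgB => //; apply: cvg_cst.
  + rewrite -(normr0 R) -(subrr (limn im)).
    by apply: cvg_norm; apply: cvgB => //; apply: cvg_cst.
Qed.
End Modulus.

(** * Infinite products of linear factors and their derivatives *)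

Section LinearFactors.
Variables (R : realType) (y : (CC R)^nat).
Implicit Types u w : CC R.

Definition linprod n u : CC R := \prod_(0 <= j < n) (1 - y j * u).

(* The derivative of [linprod n], by the product rule. *)
Fixpoint dlinprod n u : CC R :=
  if n is m.+1 then dlinprod m u * (1 - y m * u) - y m * linprod m u else 0.

(* The factor 2 lets the same majorant bound [linprod], [dlinprod] and the
   second-order Taylor remainder. *)
Definition majorant n : R := \prod_(0 <= j < n) (1 + 2 * cmod (y j)).

Lemma linprodS n u : linprod n.+1 u = linprod n u * (1 - y n * u).
Proof. by rewrite /linprod big_nat_recr. Qed.

Lemma majorantS n : majorant n.+1 = majorant n * (1 + 2 * cmod (y n)).
Proof. by rewrite /majorant big_nat_recr. Qed.

Lemma majorant_ge1 n : 1 <= majorant n.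
Proof.
elim: n => [|n IH]; first by rewrite /majorant big_geq.
by rewrite majorantS; have := cmod_ge0 (y n); nra.
Qed.

Lemma cmod_factor n u : cmod u <= 1 -> cmod (1 - y n * u) <= 1 + cmod (y n).
Proof.
move=> u1; apply: le_trans (cmodD _ _) _; rewrite cmodN cmod1 cmodM.
by have := cmod_ge0 (y n); nra.
Qed.

Lemma linprod_le n u : cmod u <= 1 -> cmod (linprod n u) <= majorant n.
Proof.
move=> u1; elim: n => [|n IH].
  by rewrite /linprod /majorant !big_geq// cmod1.
rewrite linprodS majorantS cmodM; apply: ler_pM; rewrite ?cmod_ge0//.
by apply: le_trans (cmod_factor _ u1) _; have := cmod_ge0 (y n); lra.
Qed.

Lemma dlinprod_le n u : cmod u <= 1 -> cmod (dlinprod n u) <= majorant n.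
Proof.
move=> u1; elim: n => [|n IH] /=.
  by rewrite cmod0; apply: le_trans (majorant_ge1 0).
rewrite majorantS; apply: le_trans (cmodD _ _) _.
rewrite cmodN !cmodM.
have h1 := linprod_le n u1; have h2 := cmod_factor n u1.
have h3 := ler_pM (cmod_ge0 _) (cmod_ge0 _) IH h2.
have h4 := ler_wpM2l (cmod_ge0 (y n)) h1.
by lra.
Qed.

(** Adding a factor multiplies the old remainder by [1 - y n * w] and subtracts
    [y n * (w - u) ^+ 2 * dlinprod n u]. The two contributions are at most [1 + cmod (y n)] and
    [cmod (y n)] times the old bound, which is why [majorant] grows by [1 + 2 * cmod (y n)]. *)
Lemma linprod_taylor n u w : cmod u <= 1 -> cmod w <= 1 ->
  cmod (linprod n w - linprod n u - (w - u) * dlinprod n u)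
    <= majorant n * cmod (w - u) ^+ 2.
Proof.
move=> u1 w1; elim: n => [|n IH].
  rewrite /linprod /majorant !big_geq//= subrr mulr0 subrr cmod0.
  by rewrite mul1r exprn_ge0// cmod_ge0.
rewrite !linprodS majorantS /=.
have -> : linprod n w * (1 - y n * w) - linprod n u * (1 - y n * u) -
    (w - u) * (dlinprod n u * (1 - y n * u) - y n * linprod n u) =
  (linprod n w - linprod n u - (w - u) * dlinprod n u) * (1 - y n * w)
  - y n * (w - u) ^+ 2 * dlinprod n u by ring.
apply: le_trans (cmodD _ _) _; rewrite cmodN !cmodM -!expr2.
have h1 := ler_pM (cmod_ge0 _) (cmod_ge0 _) IH (cmod_factor n w1).
have h2 := dlinprod_le n u1.
have h0 : 0 <= cmod (y n) * cmod (w - u) ^+ 2.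
  by rewrite mulr_ge0 ?exprn_ge0 ?cmod_ge0.
have h3 := ler_wpM2l h0 h2.
by lra.
Qed.

Hypothesis y_summable : cvgn (series (fun n => cmod (y n))).

(** From 1 + x <= exp x, the product is at most exp of twice the sum of the [cmod (y j)]. *)
Lemma majorant_bounded : exists2 M : R, 0 < M & forall n, majorant n <= M.
Proof.
pose S := limn (series (fun n => cmod (y n))).
exists (expR (2 * S)); first exact: expR_gt0.
move=> n; apply: (@le_trans _ _ (expR (2 * series (fun n => cmod (y n)) n))).
  elim: n => [|n IH]; first by rewrite /majorant /series/= !big_geq// mulr0 expR0.
  rewrite majorantS seriesEnat /= big_nat_recr//= [2 * (_ + _)]mulrDr expRD.
  apply: ler_pM => //; last exact: expR_ge1Dx.
    by apply: le_trans (majorant_ge1 n).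
  by have := cmod_ge0 (y n); lra.
rewrite ler_expR ler_pM2l//.
apply: nondecreasing_cvgn_le => //.
by apply: nondecreasing_series => k _ _; apply: cmod_ge0.
Qed.

Lemma summableZ (c : R) : cvgn (series (fun n => c * cmod (y n))).
Proof. exact: is_cvg_seriesZ. Qed.

Lemma cvg_linprod u : cmod u <= 1 -> cvgn (fun n => linprod n u).
Proof.
move=> u1; have [M M0 hM] := majorant_bounded.
apply: (cvg_dominated _ (@summableZ M)) => n.
rewrite linprodS.
have -> : linprod n u * (1 - y n * u) - linprod n u
  = - (linprod n u * y n * u) by ring.
rewrite cmodN !cmodM.
have h1 := le_trans (linprod_le n u1) (hM n).
have h2 := ler_wpM2r (cmod_ge0 (y n)) h1.
have h3 : 0 <= cmod (linprod n u) * cmod (y n) by rewrite mulr_ge0 ?cmod_ge0.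
by nra.
Qed.

Lemma cvg_dlinprod u : cmod u <= 1 -> cvgn (fun n => dlinprod n u).
Proof.
move=> u1; have [M M0 hM] := majorant_bounded.
apply: (cvg_dominated _ (@summableZ (2 * M))) => n /=.
have -> : dlinprod n u * (1 - y n * u) - y n * linprod n u - dlinprod n u
  = - (y n * (dlinprod n u * u + linprod n u)) by ring.
rewrite cmodN cmodM mulrC; apply: ler_wpM2r; first exact: cmod_ge0.
apply: le_trans (cmodD _ _) _; rewrite cmodM.
have h1 := le_trans (linprod_le n u1) (hM n).
have h2 := le_trans (dlinprod_le n u1) (hM n).
have := cmod_ge0 (dlinprod n u).
by nra.
Qed.

Definition infprod u : CC R := limn (fun n => linprod n u).
Definition dinfprod u : CC R := limn (fun n => dlinprod n u).

(** The bound for partial products holds with one constant for all [n], so it passes to the limit;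
    this replaces any interchange of limit and derivative. *)
Lemma infprod_taylor : exists2 M : R, 0 < M & forall u w,
  cmod u <= 1 -> cmod w <= 1 ->
  cmod (infprod w - infprod u - (w - u) * dinfprod u) <= M * cmod (w - u) ^+ 2.
Proof.
have [M M0 hM] := majorant_bounded; exists M => // u w u1 w1.
apply: (@cmod_lim_le _
  (fun n => linprod n w - linprod n u - (w - u) * dlinprod n u)).
  apply: cvgB; first by apply: cvgB; apply: cvg_linprod.
  by apply: cvgM; [exact: cvg_cst|exact: cvg_dlinprod].
move=> n; apply: le_trans (linprod_taylor n u1 w1) _.
by rewrite ler_wpM2r// exprn_ge0// cmod_ge0.
Qed.

Lemma infprod0 : infprod 0 = 1.
Proof.
apply/cvg_lim => //.
rewrite (_ : (fun n => _) = cst 1); first exact: cvg_cst.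
apply/funext => n; rewrite /linprod big1// => j _.
by rewrite mulr0 subr0.
Qed.

Lemma dlinprod0 n : dlinprod n 0 = - \sum_(0 <= j < n) y j.
Proof.
elim: n => [|n IH] /=; first by rewrite big_geq// oppr0.
have -> : linprod n 0 = 1.
  by rewrite /linprod big1// => j _; rewrite mulr0 subr0.
by rewrite IH big_nat_recr//=; ring.
Qed.

(** This turns the derivative of the product at 0 into a series: the partial derivatives at 0 are
    exactly the negated partial sums of [y]. *)
Lemma cvg_sum : (fun n => \sum_(0 <= j < n) y j) @ \oo --> - dinfprod 0.
Proof.
rewrite (_ : (fun n => _) = (fun n => - dlinprod n 0)).
  by apply: cvgN; apply: cvg_dlinprod; rewrite cmod0.
by apply/funext => n; rewrite dlinprod0 opprK.
Qed.

Lemma dinfprod_lipschitz : exists2 M : R, 0 < M & forall u,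
  cmod u <= 1 -> cmod (dinfprod u - dinfprod 0) <= M * cmod u.
Proof.
have [M M0 hM] := infprod_taylor; exists (2 * M); first by rewrite mulr_gt0.
move=> u u1; have n01 : cmod (0 : CC R) <= 1 by rewrite cmod0.
have [->|un0] := eqVneq u 0; first by rewrite subrr cmod0 mulr0.
have h1 := hM u 0 u1 n01; have h2 := hM 0 u n01 u1.
have u0 : 0 < cmod u by rewrite lt_neqAle cmod_ge0 eq_sym cmod_eq0 un0.
rewrite -(ler_pM2r u0) -cmodM.
(* Adding the Taylor remainders from [u] to 0 and from 0 to [u] cancels the values of [infprod];
   each is at most [M * cmod u ^+ 2], whence the constant [2 * M] after division by [cmod u]. *)
have -> : (dinfprod u - dinfprod 0) * u =
  (infprod 0 - infprod u - (0 - u) * dinfprod u) +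
  (infprod u - infprod 0 - (u - 0) * dinfprod 0) by ring.
apply: le_trans (cmodD _ _) _.
move: h1 h2; rewrite subr0 sub0r cmodN => h1 h2.
by move: h1 h2; set a := cmod _; set b := cmod _; rewrite expr2; lra.
Qed.

Lemma cvg_dinfprod0 : dinfprod @ (0 : CC R) --> dinfprod 0.
Proof.
have [M M0 hM] := dinfprod_lipschitz.
have c0 : cmod u @[u --> (0 : CC R)] --> (0 : R).
  have := @cvg_cmod R _ (nbhs (0 : CC R)) (nbhs_filter _) id 0 (@cvg_id _ _).
  by rewrite cmod0.
apply: (@cvg_cmod_le _ _ _ (nbhs_filter _) _ _ (fun u => M * cmod u)).
- have /cvgrPdist_lt/(_ _ ltr01) := c0.
  by apply: filterS => u; rewrite normr_cmod => /ltW /hM.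
- by rewrite -(mulr0 M); apply: cvgM => //; exact: cvg_cst.
Qed.

Lemma is_derive_infprod u : cmod u < 1 -> is_derive u 1 infprod (dinfprod u).
Proof.
move=> u1; have [M M0 hM] := infprod_taylor.
have c0 : cmod h @[h --> (0 : CC R)^'] --> (0 : R).
  have := @cvg_cmod R _ (0 : CC R)^' (dnbhs_filter _) id 0
    (@cvg_within _ _ (nbhs_filter _) _).
  by rewrite cmod0.
have H : (h^-1 *: ((infprod \o shift u) (h *: (1 : CC R)) - infprod u))
    @[h --> (0 : CC R)^'] --> dinfprod u.
  apply: (@cvg_cmod_le _ _ _ _ _ _ (fun h => M * cmod h)).
  (* The Taylor bound needs both points in the closed unit disc, so [h] is kept shorter than
     [1 - cmod u]. *)
  - have u1' : 0 < 1 - cmod u by rewrite subr_gt0.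
    have /cvgrPdist_lt/(_ _ u1') := c0.
    move=> H; near=> h.
    have hn0 : h != 0 by near: h; exact: nbhs_dnbhs_neq.
    have hh : cmod h < 1 - cmod u.
      by rewrite -normr_cmod; near: h.
    have hu : cmod (h + u) <= 1 by apply: le_trans (cmodD _ _) _; lra.
    have := hM u (h + u) (ltW u1) hu; rewrite addrK => hb.
    have h0 : 0 < cmod h by rewrite lt_neqAle cmod_ge0 eq_sym cmod_eq0 hn0.
    rewrite -(ler_pM2l h0) -cmodM /= scaler1.
    rewrite /GRing.scale/= mulrBr mulrA divff// mul1r.
    by apply: le_trans hb _; rewrite expr2; lra.
  - by rewrite -(mulr0 M); apply: cvgM => //; exact: cvg_cst.
apply: DeriveDef; first by apply/cvg_ex; eexists; exact: H.
exact: cvg_lim H.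
Unshelve. all: by end_near. Qed.

End LinearFactors.

(** * Lambert series by truncation of a double series *)

Lemma cvg_sqr_geometric (R : realType) (r : R) : 0 <= r -> r < 1 ->
  (n.+1%:R ^+ 2 * r ^+ n) @[n --> \oo] --> (0 : R).
Proof.
(* With s the fourth root of r, (n+1)^2 r^n = ((n+1) s^n)^2 s^(2n). Two powers of s^n absorb the
   polynomial factor, and what remains still decays geometrically. *)
move=> r0 r1; pose s := Num.sqrt (Num.sqrt r).
have s0 : 0 <= s by rewrite sqrtr_ge0.
have rE : r = s ^+ 4.
  by rewrite (exprM s 2 2) !sqr_sqrtr// sqrtr_ge0.
have s1 : s < 1.
  by rewrite -(@ltr_pXn2r _ 4%N) ?nnegrE// -rE expr1n.
(* Divided by 1 - s, this says that n+1 copies of s^n are at most 1 + s + ... + s^n, whose terms are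
   all at least s^n. *)
have lin n : n.+1%:R * s ^+ n * (1 - s) <= 1 - s ^+ n.+1.
  elim: n => [|n IH]; first by rewrite expr0 expr1; lra.
  have h0 : 0 <= s ^+ n.+1 by rewrite exprn_ge0.
  have h1 : s ^+ n.+1 <= 1 by rewrite exprn_ile1// ltW.
  have h2 := ler_wpM2l s0 IH.
  have h3 : 0 <= (1 - s) * (1 - s ^+ n.+1) by rewrite mulr_ge0// subr_ge0// ltW.
  have -> : n.+2%:R * s ^+ n.+1 * (1 - s) =
      s * (n.+1%:R * s ^+ n * (1 - s)) + s ^+ n.+1 * (1 - s).
    by rewrite -[n.+2]addn1 natrD exprS; ring.
  by rewrite [s ^+ n.+2]exprS; lra.
have lin' n : n.+1%:R * s ^+ n <= (1 - s)^-1.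
  rewrite -[leRHS]mul1r ler_pdivlMr ?subr_gt0//.
  by apply: le_trans (lin n) _; rewrite gerBl exprn_ge0.
apply: (@squeeze_cvgr _ _ _ _ (cst 0) (fun n => (1 - s)^-1 ^+ 2 * s ^+ n)).
- apply: nearW => n; apply/andP; split.
    by rewrite mulr_ge0 ?exprn_ge0.
  have -> : n.+1%:R ^+ 2 * r ^+ n = (n.+1%:R * s ^+ n) ^+ 2 * (s ^+ n * s ^+ n).
    by rewrite rE -exprM mulnC exprM; ring.
  apply: ler_pM; rewrite ?exprn_ge0 ?mulr_ge0 ?exprn_ge0//.
    rewrite ler_pXn2r ?nnegrE ?mulr_ge0 ?exprn_ge0// invr_ge0.
    by rewrite subr_ge0 ltW.
  by rewrite ler_piMr ?exprn_ge0// exprn_ile1// ltW.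
- exact: cvg_cst.
- rewrite -(mulr0 ((1 - s)^-1 ^+ 2)); apply: cvgM; first exact: cvg_cst.
  by apply: cvg_expr; rewrite ger0_norm.
Qed.

Section Lambert.
Variables (R : realType) (r : R) (a p : CC R).
Hypotheses (r_ge0 : 0 <= r) (r_lt1 : r < 1).
Hypotheses (a_le : cmod a <= r) (p_le : cmod p <= r).
Implicit Types (x : CC R) (m n j : nat).

Lemma cmod_1B_ge x : cmod x <= r -> 1 - r <= cmod (1 - x).
Proof. by move=> xr; have := cmodB_ge 1 x; rewrite cmod1; lra. Qed.

Lemma subr1_neq0 x : cmod x <= r -> 1 - x != 0.
Proof.
move=> /cmod_1B_ge xr; rewrite -cmod_eq0 gt_eqF//.
by apply: lt_le_trans xr; rewrite subr_gt0.
Qed.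

Lemma cmod_1BV_le x : cmod x <= r -> cmod (1 - x)^-1 <= (1 - r)^-1.
Proof.
move=> xr; rewrite cmodV lef_pV2 ?posrE ?subr_gt0 ?cmod_1B_ge//.
by apply: lt_le_trans (cmod_1B_ge xr); rewrite subr_gt0.
Qed.

Lemma cmod_geometric_le j : cmod (a * p ^+ j) <= r * r ^+ j.
Proof.
rewrite cmodM cmodX; apply: ler_pM; rewrite ?exprn_ge0 ?cmod_ge0//.
by rewrite lerXn2r ?nnegrE ?cmod_ge0.
Qed.

Lemma cmod_geometric_le_r j : cmod (a * p ^+ j) <= r.
Proof.
by apply: le_trans (cmod_geometric_le j) _; rewrite ler_piMr// exprn_ile1// ltW.
Qed.

Lemma cmod_expr_le x m : cmod x <= r -> cmod (x ^+ m) <= r ^+ m.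
Proof. by move=> xr; rewrite cmodX lerXn2r ?nnegrE ?cmod_ge0. Qed.

Lemma cmod_exprS_le x m : cmod x <= r -> cmod (x ^+ m.+1) <= r.
Proof.
move=> xr; apply: le_trans (cmod_expr_le _ xr) _.
by rewrite exprS ler_piMr// exprn_ile1// ltW.
Qed.

Lemma summable_koebe :
  cvgn (series (fun j => cmod (a * p ^+ j / (1 - a * p ^+ j) ^+ 2))).
Proof.
apply: (@series_le_cvg _ _ (geometric (r * (1 - r)^-1 ^+ 2) r)).
- by move=> n; apply: cmod_ge0.
- by move=> n /=; rewrite !mulr_ge0 ?exprn_ge0 ?invr_ge0 ?subr_ge0 ?(ltW r_lt1).
- move=> n /=; rewrite [leRHS]mulrAC cmodM -exprVn cmodX.
  apply: ler_pM; rewrite ?exprn_ge0 ?cmod_ge0 ?cmod_geometric_le//.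
  rewrite lerXn2r ?nnegrE ?cmod_ge0 ?cmod_1BV_le ?cmod_geometric_le_r//.
  by rewrite invr_ge0 subr_ge0 ltW.
- by apply: is_cvg_geometric_series; rewrite ger0_norm.
Qed.

(** The truncated form keeps its tail explicit, since the tail is what has to be estimated later. *)
Lemma sum_arith_geometric x n : 1 - x != 0 ->
  \sum_(1 <= m < n.+1) m%:R * x ^+ m =
  x / (1 - x) ^+ 2
  - x ^+ n.+1 * (n.+1%:R - n%:R * x) / (1 - x) ^+ 2.
Proof.
move=> x1; elim: n => [|n IH].
  by rewrite big_geq// mul0r subr0 expr1 mulr1 subrr.
rewrite big_nat_recr//= IH [x ^+ n.+2]exprS -[n.+2]addn1 -[n.+1]addn1 !natrD.
by field.
Qed.

Lemma sum_geometric x n : 1 - x != 0 ->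
  \sum_(0 <= j < n) x ^+ j = (1 - x ^+ n) / (1 - x).
Proof.
move=> x1; elim: n => [|n IH].
  by rewrite big_geq// expr0 subrr mul0r.
by rewrite big_nat_recr//= IH exprS; field.
Qed.

(** The square sum of m (a p^j)^m over j < n and 1 <= m <= n is evaluated in both orders. Summing
    over m first gives Koebe terms minus tails, over j first gives Lambert terms minus tails; so the
    main parts differ by the difference of the tails. *)
Lemma lambert_truncation_error n :
  \sum_(0 <= j < n) (a * p ^+ j / (1 - a * p ^+ j) ^+ 2)
  - \sum_(1 <= m < n.+1) (m%:R * a ^+ m / (1 - p ^+ m)) =
  \sum_(0 <= j < n) ((a * p ^+ j) ^+ n.+1 *
     (n.+1%:R - n%:R * (a * p ^+ j)) / (1 - a * p ^+ j) ^+ 2)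
  - \sum_(1 <= m < n.+1) (m%:R * a ^+ m * (p ^+ m) ^+ n / (1 - p ^+ m)).
Proof.
have E : \sum_(0 <= j < n) \sum_(1 <= m < n.+1) (m%:R * (a * p ^+ j) ^+ m) =
    \sum_(1 <= m < n.+1) (m%:R * a ^+ m * ((1 - (p ^+ m) ^+ n) / (1 - p ^+ m))).
  rewrite exchange_big_nat /=; apply: eq_big_nat => m /andP[m1 _].
  rewrite -sum_geometric; last first.
    by case: m m1 => // m _; rewrite subr1_neq0// cmod_exprS_le.
  rewrite mulr_sumr; apply: eq_bigr => j _.
  by rewrite exprMn -!exprM mulnC mulrA.
have E1 : \sum_(0 <= j < n) \sum_(1 <= m < n.+1) (m%:R * (a * p ^+ j) ^+ m) =
    \sum_(0 <= j < n) (a * p ^+ j / (1 - a * p ^+ j) ^+ 2) -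
    \sum_(0 <= j < n) ((a * p ^+ j) ^+ n.+1 *
     (n.+1%:R - n%:R * (a * p ^+ j)) / (1 - a * p ^+ j) ^+ 2).
  rewrite -sumrB; apply: eq_bigr => j _.
  by rewrite sum_arith_geometric// subr1_neq0// cmod_geometric_le_r.
have E2 : \sum_(1 <= m < n.+1)
      (m%:R * a ^+ m * ((1 - (p ^+ m) ^+ n) / (1 - p ^+ m))) =
    \sum_(1 <= m < n.+1) (m%:R * a ^+ m / (1 - p ^+ m)) -
    \sum_(1 <= m < n.+1) (m%:R * a ^+ m * (p ^+ m) ^+ n / (1 - p ^+ m)).
  rewrite -sumrB; apply: eq_bigr => m _; ring.
by move: E; rewrite E1 E2 => /eqP; rewrite subr_eq => /eqP ->; ring.
Qed.

Lemma cmod_sum_nat_le (f : nat -> CC R) (b : R) k n :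
  (forall i, (k <= i < k + n)%N -> cmod (f i) <= b) ->
  cmod (\sum_(k <= i < k + n) f i) <= n%:R * b.
Proof.
move=> fb; apply: le_trans (cmod_sum _ _ _) _.
apply: le_trans (ler_sum_nat fb) _.
by rewrite sumr_const_nat addKn mulr_natl.
Qed.

Lemma cvg_lambert_error :
  (\sum_(0 <= j < n) (a * p ^+ j / (1 - a * p ^+ j) ^+ 2)
   - \sum_(1 <= m < n.+1) (m%:R * a ^+ m / (1 - p ^+ m))) @[n --> \oo]
  --> (0 : CC R).
Proof.
pose d := (1 - r)^-1.
have d0 : 0 <= d by rewrite invr_ge0 subr_ge0 ltW.
(* The tails for fixed j are n terms of size at most 2 (n+1) r^n d^2, those for fixed m are n terms
   of size at most n r^n d; both counts are dominated by multiples of (n+1)^2 r^n. *)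
apply: (@cvg_cmod_le _ _ _ _ _ _
  (fun n => (2 * d ^+ 2 + d) * (n.+1%:R ^+ 2 * r ^+ n))); last first.
  rewrite -(mulr0 (2 * d ^+ 2 + d)); apply: cvgM; first exact: cvg_cst.
  exact: cvg_sqr_geometric.
apply: nearW => n; rewrite subr0 lambert_truncation_error.
apply: le_trans (cmodD _ _) _; rewrite cmodN.
have n0 : 0 <= n%:R :> R by rewrite ler0n.
have nS : n.+1%:R = n%:R + 1 :> R by rewrite -addn1 natrD.
have rn0 : 0 <= r ^+ n by rewrite exprn_ge0.
have h1 : cmod (\sum_(0 <= j < 0 + n) ((a * p ^+ j) ^+ n.+1 *
     (n.+1%:R - n%:R * (a * p ^+ j)) / (1 - a * p ^+ j) ^+ 2))
    <= n%:R * (r ^+ n * (2 * n.+1%:R) * d ^+ 2).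
  apply: cmod_sum_nat_le => j _; have xr := cmod_geometric_le_r j.
  move: (a * p ^+ j) xr => x xr.
  rewrite cmodM cmodM -exprVn.
  apply: ler_pM; rewrite ?mulr_ge0 ?exprn_ge0 ?cmod_ge0//; last first.
    by rewrite cmodX lerXn2r ?nnegrE ?cmod_ge0 ?cmod_1BV_le.
  apply: ler_pM; rewrite ?cmod_ge0//.
    apply: le_trans (cmod_expr_le _ xr) _.
    by rewrite exprS ler_piMl// ltW.
  apply: le_trans (cmodD _ _) _; rewrite cmodN cmodM !cmod_nat nS.
  by have := ler_wpM2l n0 (le_trans xr (ltW r_lt1)); lra.
have h2 : cmod (\sum_(1 <= m < 1 + n)
      (m%:R * a ^+ m * (p ^+ m) ^+ n / (1 - p ^+ m)))
    <= n%:R * (n%:R * r ^+ n * d).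
  apply: cmod_sum_nat_le => m /andP[m1]; rewrite add1n ltnS => mn.
  case: m m1 mn => // m _ mn.
  rewrite cmodM; apply: ler_pM; rewrite ?cmod_ge0 ?cmod_1BV_le ?cmod_exprS_le//.
  rewrite cmodM; apply: ler_pM; rewrite ?cmod_ge0//.
    rewrite cmodM cmod_nat -[leRHS]mulr1; apply: ler_pM; rewrite ?cmod_ge0 ?ler_nat//.
    by apply: le_trans (cmod_exprS_le _ a_le) _; rewrite ltW.
  by apply: cmod_expr_le; apply: cmod_exprS_le.
apply: le_trans (lerD h1 h2) _.
have hd : 0 <= d * r ^+ n by rewrite mulr_ge0.
have hd2 : 0 <= d ^+ 2 * r ^+ n by rewrite mulr_ge0 ?exprn_ge0.
have -> : n%:R * (r ^+ n * (2 * n.+1%:R) * d ^+ 2) + n%:R * (n%:R * r ^+ n * d)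
  = (2 * n%:R * n.+1%:R) * (d ^+ 2 * r ^+ n) + n%:R ^+ 2 * (d * r ^+ n) by ring.
have -> : (2 * d ^+ 2 + d) * (n.+1%:R ^+ 2 * r ^+ n) =
  (2 * n.+1%:R ^+ 2) * (d ^+ 2 * r ^+ n) + n.+1%:R ^+ 2 * (d * r ^+ n) by ring.
by apply: lerD; apply: ler_wpM2r => //; rewrite nS; nra.
Qed.

End Lambert.

(* The Joukowsky map shifted to have a double zero at 1. *)
Definition joukowsky (K : fieldType) (z : K) : K := z + z^-1 - 2.

(** * Pairs of q-Pochhammer symbols and the logarithmic derivative series *)

Section QPochhammer.
Variable R : realType.
Implicit Types (A Q a p z u : CC R).

Lemma cvg_qpoch A Q : cmod Q < 1 ->
  (\prod_(0 <= j < n) (1 - A * Q ^+ j)) @[n --> \oo] --> qpoch A Q.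
Proof.
move=> Q1.
have cv : cvgn (fun n => \prod_(0 <= j < n) (1 - A * Q ^+ j)).
  (* The partial products are [linprod] at [u] = 1, which the closed unit disc still includes. *)
  rewrite (_ : (fun n => _) = linprod (fun j => A * Q ^+ j) ^~ 1); last first.
    by apply/funext => n; apply: eq_bigr => j _; rewrite mulr1.
  apply: cvg_linprod; last by rewrite cmod1.
  rewrite (_ : (fun n => _) = geometric (cmod A) (cmod Q)); last first.
    by apply/funext => n; rewrite cmodM cmodX.
  by apply: is_cvg_geometric_series; rewrite ger0_norm ?cmod_ge0.
have E : (fun n => \prod_(1 <= j < n.+1) (1 - A * Q ^+ (j - 1))) =
    (fun n => \prod_(0 <= j < n) (1 - A * Q ^+ j)).
  apply/funext => n; rewrite big_add1/=; apply: eq_bigr => j _.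
  by rewrite subn1.
suff -> : qpoch A Q = limn (fun n => \prod_(0 <= j < n) (1 - A * Q ^+ j)) by [].
apply/cvg_lim => //.
by rewrite -(cvg_shiftS (fun n => \prod_(1 <= j < n) (1 - A * Q ^+ (j - 1)))) E.
Qed.

(* The Koebe function x / (1 - x)^2 along the geometric sequence x = a p^j. *)
Definition koebe a p j : CC R := a * p ^+ j / (1 - a * p ^+ j) ^+ 2.

(** The partial products [F] agree factor by factor with those of the left side, so they have both
    sides as limits. *)
Lemma qpoch_pair (r : R) a p z : r < 1 -> cmod a <= r -> cmod p <= r ->
  z != 0 -> cmod (joukowsky z) <= 1 ->
  qpoch (z * a) p * qpoch (z^-1 * a) p =
  qpoch a p ^+ 2 * infprod (koebe a p) (joukowsky z).
Proof.
move=> r1 ar pr z0 u1.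
have r0 : 0 <= r := le_trans (cmod_ge0 a) ar.
have p1 : cmod p < 1 := le_lt_trans pr r1.
pose F n := \prod_(0 <= j < n) (1 - a * p ^+ j) *
  \prod_(0 <= j < n) (1 - a * p ^+ j) * linprod (koebe a p) n (joukowsky z).
have c1 : F n @[n --> \oo] --> qpoch (z * a) p * qpoch (z^-1 * a) p.
  rewrite (_ : F = fun n => \prod_(0 <= j < n) (1 - z * a * p ^+ j) *
      \prod_(0 <= j < n) (1 - z^-1 * a * p ^+ j)).
    by apply: cvgM; apply: cvg_qpoch.
  apply/funext => n; rewrite /F /linprod -!big_split /=.
  apply: eq_bigr => j _.
  have x1 := subr1_neq0 r1 (cmod_geometric_le_r r0 r1 ar pr j).
  rewrite /koebe /joukowsky -(mulrA z a) -(mulrA z^-1 a).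
  move: (a * p ^+ j) x1 => x x1.
  by field; rewrite z0 x1.
have c2 : F n @[n --> \oo] -->
    qpoch a p * qpoch a p * infprod (koebe a p) (joukowsky z).
  apply: cvgM; first by apply: cvgM; apply: cvg_qpoch.
  exact: (cvg_linprod (y := koebe a p) (summable_koebe r0 r1 ar pr) u1).
by rewrite -(cvg_lim _ c1)// expr2 -(cvg_lim _ c2).
Qed.

(** The Koebe sums tend to [- dinfprod (koebe a p) 0], and the Lambert sums differ from them by a
    null sequence. *)
Lemma sum_lambert (r : R) a p : r < 1 -> cmod a <= r -> cmod p <= r ->
  (\sum_(1 <= m < n.+1) (m%:R * a ^+ m / (1 - p ^+ m))) @[n --> \oo]
  --> - dinfprod (koebe a p) 0.
Proof.
move=> r1 ar pr; have r0 : 0 <= r := le_trans (cmod_ge0 a) ar.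
have c1 := cvg_sum (y := koebe a p) (summable_koebe r0 r1 ar pr).
have c2 := cvg_lambert_error r0 r1 ar pr.
rewrite (_ : (fun n => _) = (fun n => \sum_(0 <= j < n) koebe a p j -
  (\sum_(0 <= j < n) koebe a p j
   - \sum_(1 <= m < n.+1) (m%:R * a ^+ m / (1 - p ^+ m))))).
  by rewrite -[X in _ --> X]subr0; apply: cvgB c1 c2.
by apply/funext => n; rewrite opprB addrC subrK.
Qed.

End QPochhammer.

(** * Chain rule and the second derivative at 1 *)

Lemma is_derive_comp1 (K : numFieldType) (f g : K -> K) (x df dg : K) :
  is_derive x 1 f df -> is_derive (f x) 1 g dg ->
  is_derive x 1 (g \o f) (dg * df).
Proof.
move=> [fx <-] [gx <-].
move: (fx) (gx) => /derivable1_diffP dfx /derivable1_diffP dgx.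
apply: DeriveDef; first by apply/derivable1_diffP/differentiable_comp.
rewrite -!derive1E derive1E'; last exact/differentiable_comp.
rewrite diff_comp // !derive1E' //= -[X in 'd  _ _ X = _]mulr1.
by rewrite [LHS]linearZ mulrC.
Qed.

Lemma is_derive_joukowsky (K : numFieldType) (z : K) : z != 0 ->
  is_derive z 1 (@joukowsky K) (1 - z ^- 2).
Proof.
move=> z0.
have dV : is_derive z 1 (fun w : K => w^-1) (- z ^- 2).
  apply: DeriveDef; first exact: (@derivableV _ _ id).
  by rewrite (@deriveV _ _ id)// derive_id /GRing.scale/= mulr1.
have := is_deriveB (is_deriveD (is_derive_id z 1) dV) (is_derive_cst (2 : K) z 1).
by rewrite subr0.
Qed.

Section SecondDerivative.
Variables (K : numFieldType) (P dP Q dQ : K -> K).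
Hypotheses (P0 : P 0 = 1) (Q0 : Q 0 = 1).
Hypothesis derP : \forall u \near (0 : K), is_derive (u : K) 1 P (dP u).
Hypothesis derQ : \forall u \near (0 : K), is_derive (u : K) 1 Q (dQ u).
Hypotheses (cvg_dP : dP @ (0 : K) --> dP 0) (cvg_dQ : dQ @ (0 : K) --> dQ 0).

Lemma near1_neq0 : \forall z \near (1 : K), z != 0.
Proof. by near=> z; near: z; apply: (cvgr_neq0 (1 : K)) (oner_neq0 _); exact: cvg_id.
Unshelve. all: by end_near. Qed.

Lemma cvg_joukowsky1 (T : Type) (F : set_system T) {FF : Filter F} (f : T -> K) :
  f @ F --> (1 : K) -> joukowsky (f t) @[t --> F] --> (0 : K).
Proof.
move=> f1; rewrite /joukowsky (_ : 0 = 1 + 1^-1 - 2 :> K); last first.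
  by rewrite invr1; ring.
by apply: cvgB (cvg_cst _); apply: cvgD => //; apply: cvgV => //; exact: oner_neq0.
Qed.

Lemma cvg_sqr1 (T : Type) (F : set_system T) {FF : Filter F} (f : T -> K) :
  f @ F --> (1 : K) -> f t ^+ 2 @[t --> F] --> (1 : K).
Proof. by move=> f1; rewrite -[X in _ --> X](mulr1 1); apply: cvgM. Qed.

(** The factor [z - 1] comes out of both inner derivatives: 1 - z^(-2) = (z-1)(z+1)/z^2, and 2z (1 -
    z^(-4)) = 2 (z-1)(z+1)(z^2+1)/z^3. *)
Lemma is_derive_joukowsky_prod (z : K) : z != 0 ->
  is_derive (joukowsky z) 1 P (dP (joukowsky z)) ->
  is_derive (joukowsky (z ^+ 2)) 1 Q (dQ (joukowsky (z ^+ 2))) ->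
  is_derive z 1 (fun w => P (joukowsky w) * Q (joukowsky (w ^+ 2)))
    ((z - 1) * ((z + 1) / z ^+ 2 * (dP (joukowsky z) * Q (joukowsky (z ^+ 2))
      + 2 * ((z ^+ 2 + 1) / z) * (P (joukowsky z) * dQ (joukowsky (z ^+ 2)))))).
Proof.
move=> z0 dPz dQz.
have z20 : z ^+ 2 != 0 by rewrite expf_neq0.
have d1 := is_derive_comp1 (is_derive_joukowsky z0) dPz.
have dsq : is_derive z 1 (fun w : K => w ^+ 2) (2 * z).
  apply: (is_derive_eq (is_deriveM (is_derive_id z 1) (is_derive_id z 1))).
  by rewrite /GRing.scale /=; ring.
have d2 := is_derive_comp1 dsq (is_derive_joukowsky z20).
have d3 := is_derive_comp1 d2 dQz.
apply: (is_derive_eq (is_deriveM d1 d3)).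
rewrite /GRing.scale /=.
set p' := dP _; set q' := dQ _; set p := P _; set q := Q _.
by field.
Qed.

(** Near 1 the first derivative is [C * ((z - 1) * k z)], so its difference quotient at 1 is
    [C * k (h + 1)]. Continuity of [k] at 1 then suffices, without second derivatives of [P] or
    [Q]. *)
Lemma derive2_joukowsky_prod (C : K) (F : K -> K) :
  (\forall z \near (1 : K), F z = C * (P (joukowsky z) * Q (joukowsky (z ^+ 2)))) ->
  derive1n 2 F 1 = C * (2 * dP 0 + 8 * dQ 0).
Proof.
move=> FE.
pose k (z : K) := (z + 1) / z ^+ 2 * (dP (joukowsky z) * Q (joukowsky (z ^+ 2))
      + 2 * ((z ^+ 2 + 1) / z) * (P (joukowsky z) * dQ (joukowsky (z ^+ 2)))).
have DP : \forall z \near (1 : K),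
    is_derive (joukowsky z : K) (1 : K) P (dP (joukowsky z)).
  exact: (@cvg_joukowsky1 _ _ (nbhs_filter _) id cvg_id _ derP).
have DQ : \forall z \near (1 : K),
    is_derive (joukowsky (z ^+ 2) : K) (1 : K) Q (dQ (joukowsky (z ^+ 2))).
  exact: (@cvg_joukowsky1 _ _ (nbhs_filter _) _
    (@cvg_sqr1 _ _ (nbhs_filter _) id cvg_id) _ derQ).
(* The formula for [F] has to hold around each nearby point, not merely at it, before it can be
   differentiated there. *)
have FE' := nbhs_interior FE.
have dF : \forall z \near (1 : K), derive1 F z = C * ((z - 1) * k z).
  near=> z.
  have z0 : z != 0 by near: z; exact: near1_neq0.
  have dPz : is_derive (joukowsky z) (1 : K) P (dP (joukowsky z)) by near: z.
  have dQz : is_derive (joukowsky (z ^+ 2)) (1 : K) Q (dQ (joukowsky (z ^+ 2))).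
    by near: z.
  have FEz : \forall w \near z, F w = C * (P (joukowsky w) * Q (joukowsky (w ^+ 2))).
    by near: z.
  rewrite derive1E (near_eq_derive _ FEz).
  have dz := is_derive_joukowsky_prod z0 dPz dQz.
  by have [_ ->] := is_deriveZ C dz.
have F1 : derive1 F 1 = 0 by rewrite (nbhs_singleton dF) subrr mul0r mulr0.
have cont (G dG : K -> K) :
    (\forall u \near (0 : K), is_derive (u : K) 1 G (dG u)) ->
    G @ (0 : K) --> G 0.
  move=> /nbhs_singleton[dG0 _].
  exact/differentiable_continuous/derivable1_diffP.
have ck (T : Type) (E : set_system T) (EE : Filter E) (f : T -> K) :
    f @ E --> (1 : K) -> k (f t) @[t --> E] --> 2 * dP 0 + 8 * dQ 0.
  move=> f1; have f2 : f t ^+ 2 @[t --> E] --> (1 : K) by exact: cvg_sqr1.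
  have cP : P (joukowsky (f t)) @[t --> E] --> (1 : K).
    by rewrite -P0; exact: (cvg_comp _ _ (cvg_joukowsky1 f1) (cont _ _ derP)).
  have cQ : Q (joukowsky (f t ^+ 2)) @[t --> E] --> (1 : K).
    by rewrite -Q0; exact: (cvg_comp _ _ (cvg_joukowsky1 f2) (cont _ _ derQ)).
  have cdP : dP (joukowsky (f t)) @[t --> E] --> dP 0.
    exact: (cvg_comp _ _ (cvg_joukowsky1 f1) cvg_dP).
  have cdQ : dQ (joukowsky (f t ^+ 2)) @[t --> E] --> dQ 0.
    exact: (cvg_comp _ _ (cvg_joukowsky1 f2) cvg_dQ).
  (* The right side is [k] at 1 written out with [P 0] and [Q 0] equal to 1, in the shape that the
     limit rules produce. *)
  have -> : 2 * dP 0 + 8 * dQ 0 = (1 + 1) / 1 *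
      (dP 0 * 1 + 2 * ((1 + 1) / 1) * (1 * dQ 0)) by field.
  have c1 : (1 : K) @[_ --> E] --> (1 : K) by exact: cvg_cst.
  have c2 : (2 : K) @[_ --> E] --> (2 : K) by exact: cvg_cst.
  rewrite /k; apply: cvgM.
    by apply: cvgM (cvgD f1 c1) (cvgV (oner_neq0 _) f2).
  apply: cvgD; first exact: cvgM.
  apply: cvgM; last exact: cvgM.
  by apply: cvgM => //; apply: cvgM (cvgD f2 c1) (cvgV (oner_neq0 _) f1).
rewrite /derive1n /= /derive1.
apply/cvg_lim => //.
have sh : h + 1 @[h --> (0 : K)^'] --> (1 : K).
  rewrite -[X in _ --> X]add0r; apply: cvgD; last exact: cvg_cst.
  exact: cvg_within.
have cC : C * k (h + 1) @[h --> (0 : K)^'] --> C * (2 * dP 0 + 8 * dQ 0).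
  by apply: cvgM (cvg_cst C) (ck _ _ _ _ sh).
apply: cvg_trans cC; apply: near_eq_cvg; near=> h.
have h0 : h != 0 by near: h; exact: nbhs_dnbhs_neq.
have dFh : derive1 F (h + 1) = C * ((h + 1 - 1) * k (h + 1)).
  by near: h; exact: (sh _ dF).
rewrite -[X in X - _]/(derive1 F (h + 1)) -[X in _ - X]/(derive1 F 1).
by rewrite F1 subr0 dFh addrK /GRing.scale /=; field.
Unshelve. all: by end_near. Qed.

End SecondDerivative.

(** * Parity splitting and the final evaluation *)

Lemma limn_shift (R : realType) (u : (CC R)^nat) (l : CC R) :
  u n.+1 @[n --> \oo] --> l -> limn u = l.
Proof. by move=> ul; apply/cvg_lim => //; rewrite -cvg_shiftS. Qed.

(** The odd terms are all terms up to 2n minus the even ones, and with x = q^m an even term is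
    rewritten by x^2/(1-x^2) = x/(1-x) - x/(1-x^2). *)
Lemma sum_parity_split (K : fieldType) (q : K) n :
  (2 != 0 :> K) -> (forall m, 1 - q ^+ m.+1 != 0) ->
  \sum_(1 <= m < n.+1)
     ((2 * m - 1)%:R * q ^+ (2 * m - 1) / (1 - q ^+ (2 * m - 1))) =
  2 * (\sum_(1 <= m < n.+1) (m%:R * q ^+ m / (1 - (q ^+ 2) ^+ m)))
  - 2 * (\sum_(1 <= m < n.+1) (m%:R * q ^+ m / (1 - q ^+ m)))
  + \sum_(1 <= m < (2 * n).+1) (m%:R * q ^+ m / (1 - q ^+ m)).
Proof.
move=> two0 q1; elim: n => [|n IH].
  by rewrite muln0 !big_geq//; ring.
rewrite mulnS addSn add1n !(big_nat_recr n.+1)//= IH.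
rewrite 2?(big_nat_recr _.+1)//=.
have -> : (2 * n.+1 - 1 = (2 * n).+1)%N by rewrite mulnS addSn subn1.
have -> : ((2 * n).+2 = 2 * n.+1)%N by rewrite mulnS addSn.
rewrite -exprM natrM.
have := q1 n; have := q1 (2 * n).+1.
have -> : ((2 * n).+2 = 2 * n.+1)%N by rewrite mulnS addSn.
rewrite mulnC exprM; set x := q ^+ n.+1 => h1 h2.
have h3 : 1 + x != 0.
  have E : 1 - x ^+ 2 = (1 - x) * (1 + x) by ring.
  by apply: contra_neq h1; rewrite E => ->; rewrite mulr0.
set a := \sum_(_ <= _ < _) _; set b := \sum_(_ <= _ < _) _.
set c := \sum_(_ <= _ < _) _; set d := _ / (1 - q ^+ _).
by field; rewrite h1 h2.
Qed.

Theorem theorem1p2 (R : realType) (q : CC R) (hq : `|q| < 1) :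
  derive1n 2 (fun z : CC R =>
      qpoch (z * q) q * qpoch (z^-1 * q) q *
      qpoch (z ^+ 2 * q) (q ^+ 2) * qpoch (z ^- 2 * q) (q ^+ 2)) 1 =
  - 2 * qpoch q q ^+ 2 * qpoch q (q ^+ 2) ^+ 2 *
    (3 * (\big[+%R/0]_(1 <= n <oo) (n%:R * q ^+ n / (1 - q ^+ n)))
     + 2 * (\big[+%R/0]_(1 <= n <oo)
              ((2 * n - 1)%:R * q ^+ (2 * n - 1) / (1 - q ^+ (2 * n - 1))))).
Proof.
pose r := cmod q.
have r1 : r < 1.
  rewrite -cmod_lt; exact: hq.
(* A single radius [r] thus serves both bases, [q] and [q ^+ 2]. *)
have q2r : cmod (q ^+ 2) <= r.
  by rewrite cmodX expr2 ler_piMr ?cmod_ge0// ltW.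
have qr : cmod q <= r by [].
have r0 : 0 <= r := cmod_ge0 q.
pose P := infprod (koebe q q); pose dP := dinfprod (koebe q q).
pose Q := infprod (koebe q (q ^+ 2)); pose dQ := dinfprod (koebe q (q ^+ 2)).
have sP := summable_koebe r0 r1 qr qr.
have sQ := summable_koebe r0 r1 qr q2r.
have near0 : \forall u \near (0 : CC R), cmod u < 1.
  have := @cvg_cmod R _ (nbhs (0 : CC R)) (nbhs_filter _) id 0 (@cvg_id _ _).
  rewrite cmod0 => /cvgrPdist_lt/(_ _ ltr01).
  by apply: filterS => u; rewrite normr_cmod.
rewrite (@derive2_joukowsky_prod _ P dP Q dQ _ _ _ _ _ _
  (qpoch q q ^+ 2 * qpoch q (q ^+ 2) ^+ 2)); first last.
- have n1 := near1_neq0 (CC R).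
  have n2 : \forall z \near (1 : CC R), cmod (joukowsky z) < 1.
    exact: (@cvg_joukowsky1 _ _ _ (nbhs_filter _) id cvg_id _ near0).
  have n3 : \forall z \near (1 : CC R), cmod (joukowsky (z ^+ 2)) < 1.
    exact: (@cvg_joukowsky1 _ _ _ (nbhs_filter _) _
      (@cvg_sqr1 _ _ _ (nbhs_filter _) id cvg_id) _ near0).
  near=> z.
  have z0 : z != 0 by near: z.
  have z20 : z ^+ 2 != 0 by rewrite expf_neq0.
  have u1 : cmod (joukowsky z) <= 1 by apply: ltW; near: z.
  have u2 : cmod (joukowsky (z ^+ 2)) <= 1 by apply: ltW; near: z.
  have e1 := qpoch_pair r1 qr qr z0 u1.
  have e2 := qpoch_pair r1 qr q2r z20 u2.
  by rewrite -[LHS]mulrA [X in X * _]e1 [X in _ * X]e2 mulrACA.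
- exact: (cvg_dinfprod0 sQ).
- exact: (cvg_dinfprod0 sP).
- by apply: filterS near0 => u; apply: (is_derive_infprod sQ).
- by apply: filterS near0 => u; apply: (is_derive_infprod sP).
- exact: infprod0.
- exact: infprod0.
have cA := sum_lambert r1 qr qr.
have cB := sum_lambert r1 qr q2r.
rewrite -/dP in cA; rewrite -/dQ in cB.
have lA : \big[+%R/0]_(1 <= n <oo) (n%:R * q ^+ n / (1 - q ^+ n)) = - dP 0.
  apply: limn_shift; exact: cA.
pose A n : CC R := \sum_(1 <= m < n.+1) (m%:R * q ^+ m / (1 - q ^+ m)).
pose B n : CC R := \sum_(1 <= m < n.+1) (m%:R * q ^+ m / (1 - (q ^+ 2) ^+ m)).
(* By the parity splitting this is the partial sum over odd indices; [A] tends to [- dP 0], also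
   along even indices, and [B] to [- dQ 0]. *)
have cO : (2 * B n - 2 * A n + A (2 * n)%N) @[n --> \oo] -->
    2 * - dQ 0 - 2 * - dP 0 + - dP 0.
  have cvg2 : (fun n => 2 * n)%N @ \oo --> \oo by exact: cvg_mulnl.
  apply: cvgD; last exact: (cvg_comp _ _ cvg2 cA).
  have c2 : (2 : CC R) @[_ --> \oo] --> (2 : CC R) by exact: cvg_cst.
  exact: (cvgB (cvgM c2 cB) (cvgM c2 cA)).
have lO : \big[+%R/0]_(1 <= n <oo)
    ((2 * n - 1)%:R * q ^+ (2 * n - 1) / (1 - q ^+ (2 * n - 1))) =
    2 * - dQ 0 - 2 * - dP 0 + - dP 0.
  apply: limn_shift.
  apply: cvg_trans cO; apply: near_eq_cvg; apply: nearW => n.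
  apply/esym/sum_parity_split; first by rewrite pnatr_eq0.
  by move=> m; apply: (subr1_neq0 r1); apply: (cmod_exprS_le r0 r1).
(* The two series are -P'(0) and P'(0) - 2 Q'(0), and -2 (3 (-P'(0)) + 2 (P'(0) - 2 Q'(0))) = 2
   P'(0) + 8 Q'(0). *)
rewrite [X in 3 * X]lA.
rewrite [X in _ + 2 * X]lO.
move: (dP 0) (dQ 0) => x y.
move: (qpoch q q) (qpoch q (q ^+ 2)) => z w.
by ring.
Unshelve. all: by end_near. Qed.
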